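(* Let $\boldsymbol{Y}$ be a downward run chain on the poset $(S, \preceq)$ with transition function $Q$, and let $G(x) = \mathbb{P}_e(U_x \le U_e)$ for $x \in S$. Then $\boldsymbol{Y}$ is recurrent. Moreover, $\boldsymbol{Y}$ is positive recurrent if and only if $\nu(e) := \sum_{x \in S} G(x)$ is finite, and in this case the invariant probability density function $g$ is given by $g(x) = G(x)/\nu(e)$ for $x \in S$; equivalently $\mathbb{E}_x(U_x) = \nu(e)/G(x)$ for $x \in S$.
   Context: $(S, \preceq)$ is a discrete (countable) partially ordered set with a minimum element $e$, such that for every $x \in S$ every chain (totally ordered subset) in $S$ from $e$ to $x$ is finite. An element $y$ covers $x$ if $y$ is a minimal element of $\{t \in S : t \succ x\}$. For $x \in S$, $B_x = \{w \in S : x \text{ covers } w\}$. A downward run chain on $(S, \preceq)$ is a (time-homogeneous, discrete-time) Markov chain $(Y_0, Y_1, \ldots)$ on $S$ whose transition function $Q$ satisfies $Q(x,y) > 0$ if and only if either $x = e$ and $y \in S$, or $x \in S - \{e\}$ and $y \in B_x$. $\mathbb{P}_x$, $\mathbb{E}_x$ denote probability and expectation given $Y_0 = x$, and $U_x = \min\{n \ge 1 : Y_n = x\}$ is the first positive hitting time of $x$. *)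

(* Defs.v *)
From HB Require Import structures.
From mathcomp Require Import all_boot all_order all_algebra.
From mathcomp Require Import all_classical all_reals all_analysis.

Set Implicit Arguments.
Unset Strict Implicit.
Unset Printing Implicit Defensive.

Import Order.TTheory GRing.Theory Num.Theory.

Local Open Scope classical_set_scope.
Local Open Scope ring_scope.

Definition minimum_element (o : Order.disp_t) (S : porderType o) (e : S)
    : Prop :=
  forall x : S, (e <= x)%O.

Definition minimal_element (o : Order.disp_t) (S : porderType o)
    (A : set S) (y : S) : Prop :=
  A y /\ forall t : S, A t -> ~ (t < y)%O.

Definition covers (o : Order.disp_t) (S : porderType o) (y x : S) : Prop :=
  minimal_element [set t : S | (x < t)%O] y.

Definition lower_covers (o : Order.disp_t) (S : porderType o) (x : S)
    : set S :=
  [set w : S | covers x w].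

(* A chain from x to y need not be saturated, but x and y belong to it. *)
Definition chain_from_to (o : Order.disp_t) (S : porderType o) (x y : S)
    (C : set S) : Prop :=
  [/\ total_on C (fun s t : S => (s <= t)%O), C x, C y
    & forall t : S, C t -> (x <= t)%O /\ (t <= y)%O].

Definition transition_function (R : realType) (S : choiceType)
    (Q : S -> S -> R) : Prop :=
  (forall x y : S, 0 <= Q x y) /\
  (forall x : S, \esum_(y in [set: S]) (Q x y)%:E = 1%E).

(* S carries the discrete sigma-algebra. The law of the chain started at x is
   P x, on a measurable space common to all starting states. The third clause
   is the time-homogeneous Markov property
     P_x(Y_{n+1} = y | Y_0 = s_0, ..., Y_n = s_n) = Q(s_n, y)
   multiplied by the probability of the conditioning event. *)
Definition markov_chain (R : realType) (S : choiceType) (d : measure_display)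
    (T : measurableType d) (P : S -> probability T R) (Y : nat -> T -> S)
    (Q : S -> S -> R) : Prop :=
  [/\ forall (n : nat) (A : set S), measurable (Y n @^-1` A),
      forall x : S, P x [set w : T | Y 0%N w = x] = 1%E
    & forall (x : S) (n : nat) (s : nat -> S) (y : S),
        P x [set w : T | (forall k : nat, (k <= n)%N -> Y k w = s k) /\
                         Y n.+1 w = y]
        = (P x [set w : T | forall k : nat, (k <= n)%N -> Y k w = s k]
           * (Q (s n) y)%:E)%E].

Definition downward_run_transition (R : realType) (o : Order.disp_t)
    (S : porderType o) (e : S) (Q : S -> S -> R) : Prop :=
  forall x y : S,
    0 < Q x y <-> (x = e \/ (x <> e /\ lower_covers x y)).

Definition downward_run_chain (R : realType) (o : Order.disp_t)
    (S : porderType o) (e : S) (d : measure_display) (T : measurableType d)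
    (P : S -> probability T R) (Y : nat -> T -> S) (Q : S -> S -> R) : Prop :=
  [/\ transition_function Q, markov_chain P Y Q
    & downward_run_transition e Q].

(* The infimum is a minimum when x is visited at some positive time, and +oo
   otherwise. *)
Definition hitting_time (R : realType) (S T : Type) (Y : nat -> T -> S)
    (x : S) (w : T) : \bar R :=
  ereal_inf [set (n%:R)%:E | n in [set n : nat | (1 <= n)%N /\ Y n w = x]].

Definition recurrent (R : realType) (S : choiceType) (d : measure_display)
    (T : measurableType d) (P : S -> probability T R) (Y : nat -> T -> S)
    : Prop :=
  forall x : S, P x [set w : T | (hitting_time R Y x w < +oo)%E] = 1%E.

Definition expected_return_time (R : realType) (S : choiceType)
    (d : measure_display) (T : measurableType d) (P : S -> probability T R)
    (Y : nat -> T -> S) (x : S) : \bar R :=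
  (\int[P x]_w hitting_time R Y x w)%E.

Definition positive_recurrent (R : realType) (S : choiceType)
    (d : measure_display) (T : measurableType d) (P : S -> probability T R)
    (Y : nat -> T -> S) : Prop :=
  forall x : S, (expected_return_time P Y x < +oo)%E.

Definition hit_before_return (R : realType) (S : choiceType)
    (d : measure_display) (T : measurableType d) (P : S -> probability T R)
    (Y : nat -> T -> S) (e x : S) : \bar R :=
  P e [set w : T | (hitting_time R Y x w <= hitting_time R Y e w)%E].

Definition total_hit_before_return (R : realType) (S : choiceType)
    (d : measure_display) (T : measurableType d) (P : S -> probability T R)
    (Y : nat -> T -> S) (e : S) : \bar R :=
  \esum_(x in [set: S]) hit_before_return P Y e x.

Definition invariant_density (R : realType) (S : choiceType)
    (Q : S -> S -> R) (g : S -> R) : Prop :=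
  [/\ forall x : S, 0 <= g x,
      \esum_(x in [set: S]) (g x)%:E = 1%E
    & forall y : S, \esum_(x in [set: S]) (g x * Q x y)%:E = (g y)%:E].

(* Main.v *)
Require Import Defs.
From HB Require Import structures.
From mathcomp Require Import all_boot all_order all_algebra.
From mathcomp Require Import all_classical all_reals all_analysis.
From mathcomp Require Import measurable_realfun lra.

Set Implicit Arguments.
Unset Strict Implicit.
Unset Printing Implicit Defensive.

Import Order.TTheory GRing.Theory Num.Theory.

Local Open Scope classical_set_scope.
Local Open Scope ring_scope.

(** Everything is computed from one family of numbers, the taboo transition
    probabilities: [taboo Q y n x z] is the probability that the chain started
    at x is at z at time n+1 without having been at y at the times 1, ..., n.
    Its sum over n at z = y is P_x(U_y < oo), its sum over z is
    P_x(U_y > n), and for x = y = e its sum over n is the expected number of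
    visits to z during one excursion from e.  That these
    numbers are probabilities of events of the chain is
    [probability_avoids_at].

    Recurrence ([hit_prob_eq1]).  Let F(x) = P_x(U_y < oo).  First-step analysis
    reads F(x) = Q(x,y) + sum over z <> y of Q(x,z) F(z).  Off e the chain goes
    down in the order, which is well founded because chains from e are finite
    ([finite_chains_wf]), so induction gives F >= F(e) everywhere;
    the equation at e then yields F(e) >= Q(e,y) + (1 - Q(e,y)) F(e), whence
    F(e) = 1 because Q(e,y) > 0 and F <= 1.

    The invariant measure.  After the jump from e the path is almost surely
    strictly decreasing until it is back at e, so in one excursion a state x is
    visited at most once, and G(x) is the expected number of visits to x in an
    excursion ([hit_before_returnE]).  As for every recurrent chain, this
    occupation measure satisfies G Q = G ([excursion_visits_invariant]), and its mass is the mean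
    length of an excursion, nu(e) = E_e(U_e) ([expected_return_time_min]).

    Kac's formula ([invariant_density_return]).  Let g be any invariant density.
    Stationarity gives P_g(U_y = n+1) = g(y) P_y(U_y > n) for all n.  Summing over
    n, the left side adds up to 1 by recurrence and the right side to
    g(y) E_y(U_y).  So g(y) = 1 / E_y(U_y) is forced; applied to G / nu(e) when
    nu(e) is finite, this gives E_y(U_y) = nu(e) / G(y), positive recurrence, and
    uniqueness of the invariant density.  Conversely positive recurrence at e
    is the finiteness of nu(e). *)

(** * Sums of nonnegative families *)

Section sums.
Local Open Scope ereal_scope.

(** The constant may be infinite: either all terms vanish, or a single positive
    term makes both sides infinite. *)
Lemma ge0_esumZl (R : realType) (I : choiceType) (A : set I) (c : \bar R)
    (a : I -> \bar R) :
  0 <= c -> (forall i, 0 <= a i) ->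
  \esum_(i in A) (c * a i) = c * \esum_(i in A) a i.
Proof.
case: c => [r r0 a0|_ a0|//].
  rewrite /esum -ereal_supZl//; last first.
    apply/set0P; exists (\sum_(i \in set0) a i), set0 => //.
    exact: fsets_set0.
  congr ereal_sup; apply/seteqP; split => [_ [F ? <-]|_ [_ [F ? <-] <-]].
    by exists (\sum_(i \in F) a i); [exists F|rewrite ge0_mule_fsumr].
  by exists F => //; rewrite ge0_mule_fsumr.
have [a_eq0|] := pselect (forall i, A i -> a i = 0).
  by rewrite !esum1 ?mule0// => i Ai; rewrite a_eq0 ?mule0.
move=> /existsNP[i /not_implyP[Ai /eqP ai0]].
have ai_gt0 : 0 < a i by rewrite lt0e ai0 a0.
have le_i (b : I -> \bar R) : (forall i, 0 <= b i) -> b i <= \esum_(j in A) b j.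
  move=> b0; rewrite (esumID [set i])//; rewrite (_ : A `&` [set i] = [set i]).
    by rewrite esum_set1// leeDl// esum_ge0.
  by apply/seteqP; split => [j []|j ->].
rewrite gt0_mulye ?(lt_le_trans ai_gt0) ?le_i//.
apply/eqP; rewrite -leye_eq -[leLHS](gt0_mulye ai_gt0).
by apply: (le_i (fun j => +oo * a j)) => j; rewrite mule_ge0.
Qed.

(** Tonelli's theorem for sums. *)
Lemma esum_exchange (R : realType) (I J : choiceType) (A : set I) (B : set J)
    (a : I -> J -> \bar R) :
  (forall i j, 0 <= a i j) ->
  \esum_(i in A) \esum_(j in B) a i j = \esum_(j in B) \esum_(i in A) a i j.
Proof.
move=> a0; rewrite !esum_esum//.
apply: (reindex_esum _ _ (fun k : J * I => (k.2, k.1))); split.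
- by move=> [j i] [/= ? ?].
- by move=> [j i] [j' i'] _ _ /= [-> ->].
- by move=> [i j] [/= ? ?]; exists (j, i).
Qed.

Lemma esumD1 (R : realType) (I : choiceType) (i : I) (a : I -> \bar R) :
  (forall j, 0 <= a j) ->
  \esum_(j in [set: I]) a j = a i + \esum_(j in [set~ i]) a j.
Proof. by move=> a0; rewrite (esumID [set i])// !setTI esum_set1. Qed.

Lemma le_esum_term (R : realType) (I : choiceType) (i : I) (a : I -> \bar R) :
  (forall j, 0 <= a j) -> a i <= \esum_(j in [set: I]) a j.
Proof. by move=> a0; rewrite (esumD1 i)// leeDl// esum_ge0. Qed.

Lemma esum_nat_recl (R : realType) (a : nat -> \bar R) :
  (forall n, 0 <= a n) ->
  \esum_(n in [set: nat]) a n = a 0%N + \esum_(n in [set: nat]) a n.+1.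
Proof.
move=> a0; rewrite (esumD1 0%N)//; congr (_ + _); apply: reindex_esum; split.
- by [].
- by move=> m n _ _ [].
- by move=> [|n] //= _; exists n.
Qed.

(** The law of total probability along a map with countable range. *)
Lemma measure_partition (R : realType) d (T : measurableType d)
    (mu : {measure set T -> \bar R}) (C : choiceType) (X : T -> C) (A : set T) :
  countable [set: C] -> measurable A ->
  (forall c, measurable (X @^-1` [set c])) ->
  mu A = \esum_(c in [set: C]) mu (A `&` X @^-1` [set c]).
Proof.
move=> /countable_injP[f finj] mA mX.
have f_inj : injective f by move=> c c' fcc'; apply: finj fcc'; rewrite inE.
pose F n := A `&` (f \o X) @^-1` [set n].
have F_f c : F (f c) = A `&` X @^-1` [set c].
  apply/seteqP; split => w [Aw /= Xw]; split=> //=; last by rewrite Xw.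
  exact: f_inj.
have mF n : measurable (F n).
  have [[c <-]|no] := pselect (exists c, f c = n).
    by rewrite F_f; apply: measurableI.
  rewrite (_ : F n = set0)//; apply/seteqP; split => // w [_ /= wn].
  by apply: no; exists (X w).
have tF : trivIset setT F by move=> m n _ _ [w [[_ <-] [_ <-]]].
have AF : A = \bigcup_n F n.
  by apply/seteqP; split => [w Aw|w [n _ []]//]; exists (f (X w)).
rewrite [in LHS]AF measure_bigcup// nneseries_esum// (esumID (range f))//.
rewrite [X in _ + X]esum1 ?adde0; last first.
  move=> n [_ nf]; rewrite (_ : F n = set0)//.
  by apply/seteqP; split => // w [_ /= wn]; apply: nf; exists (X w).
rewrite (_ : _ `&` _ = f @` setT); last first.
  by apply/seteqP; split => [n []//|n fn]; split => //=; rewrite inE.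
rewrite esum_image; last by move=> c c' _ _ /f_inj.
by apply: eq_esum => c _; rewrite F_f.
Qed.

End sums.

(** * Taboo probabilities of a transition function *)

Section taboo.
Local Open Scope ereal_scope.
Variables (R : realType) (S : choiceType) (Q : S -> S -> R).
Hypothesis Q_transition : transition_function Q.

(** The probability of the paths from x to z in n+1 steps whose n intermediate
    states all differ from y. *)
Fixpoint taboo (y : S) (n : nat) (x z : S) : \bar R :=
  if n is m.+1 then \esum_(w in [set~ y]) taboo y m x w * (Q w z)%:E
  else (Q x z)%:E.

(** Decomposition of the event that y is ever hit, over the time of the first
    visit. *)
Definition hit_prob (y x : S) : \bar R :=
  \esum_(n in [set: nat]) taboo y n x y.

(** The probability that y is not visited at the times 1, ..., n: the sum over
    the position at time n+1 puts no constraint on that position. *)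
Definition avoid_prob (y : S) (n : nat) (x : S) : \bar R :=
  \esum_(z in [set: S]) taboo y n x z.

(** The expected number of visits to x at positive times up to the first return
    to e, that return included. *)
Definition excursion_visits (e x : S) : \bar R :=
  \esum_(n in [set: nat]) taboo e n e x.

Let Q_ge0 x z : 0 <= (Q x z)%:E.
Proof. by rewrite lee_fin; case: Q_transition. Qed.

Let Q_sum1 x : \esum_(z in [set: S]) (Q x z)%:E = 1.
Proof. by case: Q_transition. Qed.

Hint Resolve Q_ge0 : core.

Lemma taboo_ge0 y n x z : 0 <= taboo y n x z.
Proof.
elim: n x z => [|n IHn] x z //=.
by apply: esum_ge0 => w _; rewrite mule_ge0.
Qed.
Hint Resolve taboo_ge0 : core.

Lemma tabooSr y n x z :
  taboo y n.+1 x z = \esum_(w in [set~ y]) taboo y n x w * (Q w z)%:E.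
Proof. by []. Qed.

(** [taboo] is defined by its last step; splitting off the first step instead is
    associativity of matrix powers, since all intermediate states obey the same
    constraint. *)
Lemma tabooSl y n x z :
  taboo y n.+1 x z = \esum_(w in [set~ y]) (Q x w)%:E * taboo y n w z.
Proof.
elim: n x z => [|n IHn] x z //.
rewrite tabooSr; under eq_esum => w _.
  rewrite IHn muleC -ge0_esumZl//; last by move=> v; rewrite mule_ge0.
over.
rewrite esum_exchange; last by move=> *; rewrite !mule_ge0.
apply: eq_esum => v _; rewrite tabooSr -ge0_esumZl//; last first.
  by move=> w; rewrite mule_ge0.
by apply: eq_esum => w _; rewrite muleC -muleA.
Qed.

Lemma hit_prob_ge0 y x : 0 <= hit_prob y x.
Proof. exact: esum_ge0. Qed.
Hint Resolve hit_prob_ge0 : core.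

Lemma avoid_prob_ge0 y n x : 0 <= avoid_prob y n x.
Proof. exact: esum_ge0. Qed.
Hint Resolve avoid_prob_ge0 : core.

Lemma excursion_visits_ge0 e x : 0 <= excursion_visits e x.
Proof. exact: esum_ge0. Qed.
Hint Resolve excursion_visits_ge0 : core.

Lemma hit_prob_first_step y x :
  hit_prob y x = (Q x y)%:E + \esum_(z in [set~ y]) (Q x z)%:E * hit_prob y z.
Proof.
rewrite /hit_prob esum_nat_recl//; congr (_ + _).
under eq_esum do rewrite tabooSl.
rewrite esum_exchange; last by move=> *; rewrite !mule_ge0.
by apply: eq_esum => z _; rewrite ge0_esumZl.
Qed.

Lemma avoid_prob0 y x : avoid_prob y 0 x = 1.
Proof. exact: Q_sum1. Qed.

Lemma avoid_prob_rec y n x :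
  avoid_prob y n x = taboo y n x y + avoid_prob y n.+1 x.
Proof.
rewrite {1}/avoid_prob (esumD1 y)//; congr (_ + _).
rewrite /avoid_prob /= esum_exchange; last by move=> *; rewrite mule_ge0.
by apply: eq_esum => w _; rewrite ge0_esumZl// Q_sum1 mule1.
Qed.

Lemma avoid_prob_hit y n x :
  \sum_(0 <= k < n) taboo y k x y + avoid_prob y n x = 1.
Proof.
elim: n => [|n <-]; first by rewrite big_nil add0e avoid_prob0.
by rewrite big_nat_recr//= [in RHS]avoid_prob_rec addeA.
Qed.

Lemma hit_prob_le1 y x : hit_prob y x <= 1.
Proof.
rewrite /hit_prob -nneseries_esumT//.
apply: lime_le; first exact: is_cvg_nneseries.
by apply: nearW => n; rewrite -(avoid_prob_hit y n x) leeDl.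
Qed.

Lemma taboo_le1 y n x z : taboo y n x z <= 1.
Proof.
apply: (@le_trans _ _ (avoid_prob y n x)); first exact: le_esum_term.
by rewrite -[leRHS](avoid_prob_hit y n x) leeDr// sume_ge0.
Qed.

(** A chain that descends a well-founded order from every state other than e,
    and may jump from e to any state, hits every state: along a descent the
    hitting probability is an average of 1 and of hitting probabilities of lower
    states, so it is smallest at e, and there it is at least
    Q(e,y) + (1 - Q(e,y)) F(e) with Q(e,y) > 0. *)
Lemma hit_prob_eq1 (lt : S -> S -> Prop) (e : S) :
  well_founded lt ->
  (forall x z, x <> e -> (0 < Q x z)%R -> lt z x) ->
  (forall z, (0 < Q e z)%R) ->
  forall y x, hit_prob y x = 1.
Proof.
move=> lt_wf Q_lt Qe y.
have le_e x : hit_prob y e <= hit_prob y x.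
  elim/(well_founded_ind lt_wf): x => x IHx.
  have [->//|/eqP xe] := eqVneq x e.
  rewrite -[leLHS]mule1 -(Q_sum1 x) -ge0_esumZl// (esumD1 y); last first.
    by move=> z; rewrite mule_ge0.
  rewrite (hit_prob_first_step y x) leeD//.
    by rewrite -[leRHS]mul1e lee_wpmul2r// hit_prob_le1.
  apply: le_esum => z _; rewrite muleC; have [Qxz|Qxz] := ltP 0%R (Q x z).
    by rewrite lee_wpmul2l// IHx//; exact: Q_lt.
  have -> : Q x z = 0%R by apply/le_anti; rewrite Qxz (proj1 Q_transition).
  by rewrite !mul0e.
have e_ge1 : 1 <= hit_prob y e.
  have h_fin : hit_prob y e \is a fin_num.
    by rewrite ge0_fin_numE//; exact: le_lt_trans (hit_prob_le1 _ _) (ltry _).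
  have := Q_sum1 e; rewrite (esumD1 y)//.
  set r := \esum_(_ in _) _ => Qr1.
  have r0 : 0 <= r by exact: esum_ge0.
  have r_fin : r \is a fin_num.
    by rewrite ge0_fin_numE//; apply: le_lt_trans (ltry 1); rewrite -Qr1 leeDr.
  have : (Q e y)%:E + r * hit_prob y e <= hit_prob y e.
    rewrite [leRHS]hit_prob_first_step leeD2l// muleC -ge0_esumZl//.
    by apply: le_esum => z _; rewrite muleC lee_wpmul2l.
  move: Qr1 (Qe y); rewrite -(fineK r_fin) -(fineK h_fin).
  move: (fine r) (fine _) => r' h; rewrite -EFinD -EFinM -EFinD !lee_fin.
  by move=> [] /(canRL (addKr _)) -> q0; nra.
by move=> x; apply/eqP; rewrite eq_le hit_prob_le1 (le_trans e_ge1).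
Qed.

(** Kac's formula: the sum over n is E_y(U_y).  Under the stationary law, the
    probability v_n of a first visit to y at time n+1 drops from n to n+1 by
    exactly the probability that the chain is at y at time 0 and returns
    first at time n+1, so v_n = g(y) P_y(U_y > n). *)
Lemma invariant_density_return (g : S -> R) (y : S) :
  (forall x, hit_prob y x = 1) -> invariant_density Q g ->
  (g y)%:E * (\esum_(n in [set: nat]) avoid_prob y n y) = 1.
Proof.
move=> hit1 [g_ge0 g_sum1 gQ].
have g0 x : 0 <= (g x)%:E by rewrite lee_fin.
have v n : \esum_(x in [set: S]) (g x)%:E * taboo y n x y
    = (g y)%:E * avoid_prob y n y.
  elim: n => [|n IHn].
    by rewrite avoid_prob0 mule1 -gQ; apply: eq_esum => x _; rewrite EFinM.
  have gtaboo_fin : (g y)%:E * taboo y n y y \is a fin_num.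
    rewrite fin_numM// ge0_fin_numE//.
    exact: le_lt_trans (taboo_le1 _ _ _ _) (ltry _).
  rewrite -[LHS](addeK _ gtaboo_fin) -[RHS](addeK _ gtaboo_fin); congr (_ - _).
  rewrite ![_ + (g y)%:E * taboo _ _ _ _]addeC -ge0_muleDr// -avoid_prob_rec.
  rewrite -IHn [RHS](esumD1 y); last first.
    by move=> x; rewrite mule_ge0.
  congr (_ + _); under eq_esum => x _.
    rewrite tabooSl -ge0_esumZl//; last by move=> z; rewrite mule_ge0.
  over.
  rewrite esum_exchange; last by move=> x z; rewrite !mule_ge0.
  apply: eq_esum => z _; rewrite -gQ muleC -ge0_esumZl//; last first.
    by move=> x; rewrite EFinM mule_ge0.
  by apply: eq_esum => x _; rewrite EFinM muleA muleC.
(* Summed over n, the first-visit probabilities give the total probability of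
   hitting y under the law g, which is 1. *)
rewrite -ge0_esumZl//; under eq_esum do rewrite -v.
rewrite esum_exchange; last by move=> n x; rewrite mule_ge0.
rewrite -g_sum1; apply: eq_esum => x _.
by rewrite ge0_esumZl// -/(hit_prob y x) hit1 mule1.
Qed.

Lemma excursion_visits_mass e :
  \esum_(x in [set: S]) excursion_visits e x
  = \esum_(n in [set: nat]) avoid_prob e n e.
Proof. exact: esum_exchange. Qed.

(** Each visit but the first of an excursion is reached by one step from an
    earlier state of the same excursion that is not e; the first is reached from
    e, and almost sure return to e provides the missing term z = e with
    weight 1. *)
Lemma excursion_visits_invariant e x :
  hit_prob e e = 1 ->
  \esum_(z in [set: S]) excursion_visits e z * (Q z x)%:E
  = excursion_visits e x.
Proof.
move=> hit_e; rewrite (esumD1 e); last by move=> z; rewrite mule_ge0.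
rewrite [X in X * _]hit_e mul1e [RHS]esum_nat_recl//; congr (_ + _).
under [RHS]eq_esum do rewrite tabooSr.
rewrite esum_exchange; last by move=> n z; rewrite mule_ge0.
apply: eq_esum => z _.
by rewrite muleC -ge0_esumZl//; apply: eq_esum => n _; rewrite muleC.
Qed.

End taboo.

(** * Hitting times along one trajectory *)

Section hitting_time.
Local Open Scope ereal_scope.
Variables (R : realType) (S T : Type) (Y : nat -> T -> S).

Definition avoids (y : S) (n : nat) : set T :=
  [set w | forall k : nat, (0 < k <= n)%N -> Y k w <> y].

Lemma hitting_timeP (y : S) (w : T) :
  (exists n : nat, [/\ avoids y n w, Y n.+1 w = y
     & hitting_time R Y y w = (n.+1%:R)%:E]) \/
  ((forall n, avoids y n w) /\ hitting_time R Y y w = +oo).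
Proof.
have [[m Ym]|no] := pselect (exists n : nat, Y n.+1 w = y); last first.
  right; split=> [n [//|k] _ Yk|]; first by apply: no; exists k.
  rewrite /hitting_time (_ : [set n : nat | _] = set0).
    by rewrite image_set0 ereal_inf0.
  by apply/seteqP; split => // -[|k] [] // _ Yk; apply: no; exists k.
have ex : exists n : nat, `[< Y n.+1 w = y >] by exists m; apply/asboolP.
left; have [n /asboolP Yn n_min] := ex_minnP ex.
have avoid_n : avoids y n w.
  move=> [//|k] /= kn Yk; suff : (n <= k)%N by rewrite leqNgt kn.
  by apply: n_min; apply/asboolP.
exists n; split => //; apply/eqP; rewrite eq_le; apply/andP; split.
  by apply: ereal_inf_lbound; exists n.+1.
apply/ereal_infP => _ [[|k] [//= _ Yk] <-].
by rewrite lee_fin ler_nat ltnS n_min//; apply/asboolP.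
Qed.

Lemma hitting_time_lty (y : S) (w : T) :
  hitting_time R Y y w < +oo <-> exists n : nat, avoids y n w /\ Y n.+1 w = y.
Proof.
have [[n [avoid_n Yn ->]]|[avoid_all ->]] := hitting_timeP y w.
  by rewrite ltry; split => // _; exists n.
rewrite ltxx; split => // -[n [_ Yn]].
by have := avoid_all n.+1 n.+1; rewrite leqnn /= => /(_ isT).
Qed.

(** The second alternative is the case of two infinite hitting times. *)
Lemma hitting_time_le (x y : S) (w : T) :
  hitting_time R Y x w <= hitting_time R Y y w <->
  (exists n : nat, avoids y n w /\ Y n.+1 w = x) \/
  (forall n, avoids x n w /\ avoids y n w).
Proof.
have [[n [avoid_n Yn ->]]|[avoid_x ->]] := hitting_timeP x w.
  have [[m [avoid_m Ym ->]]|[avoid_y ->]] := hitting_timeP y w.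
    rewrite lee_fin ler_nat ltnS; split.
      move=> nm; left; exists n; split => // k /andP[k0 kn].
      by apply: avoid_m; rewrite k0 (leq_trans kn).
    move=> [[k [avoid_k Yk]]|/(_ m.+1)[_ /(_ m.+1)]]; last first.
      by rewrite leqnn => /(_ isT).
    rewrite leqNgt; apply/negP => mn.
    have [km|mk] := ltnP m k.
      by apply: (avoid_k m.+1).
    by apply: (avoid_n k.+1) => //; rewrite /= (leq_ltn_trans mk).
  by rewrite leey; split => // _; left; exists n.
split=> [|[[n [_ Yn]]|avoid_both]].
- rewrite leye_eq => /eqP hy; right=> n; split => //.
  by have [[m [_ _]]|[]//] := hitting_timeP y w; rewrite hy.
- by case: (avoid_x n.+1 n.+1) => //=.
- have [[m [_ Ym ->]]|[_ ->]//] := hitting_timeP y w.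
  by have [_ /(_ m.+1)] := avoid_both m.+1; rewrite leqnn => /(_ isT).
Qed.

Lemma esum_lt_nat (m : nat) :
  \esum_(n in [set: nat]) ((n < m)%N%:R : R)%:E = (m%:R)%:E.
Proof.
elim: m => [|m IHm]; first by rewrite esum1.
by rewrite esum_nat_recl// -[in RHS]natr1 addrC EFinD -IHm.
Qed.

(** A finite sum would satisfy s = 1 + s. *)
Lemma esum_nat1 : \esum_(n in [set: nat]) (1 : \bar R) = +oo.
Proof.
apply/eqP; rewrite -leye_eq leNgt; apply/negP => s_fin.
set s := esum _ _ in s_fin.
have s_ge0 : 0 <= s by exact: esum_ge0.
have : s = 1 + s by rewrite {1}/s esum_nat_recl.
rewrite -(@fineK _ s) ?ge0_fin_numE// -EFinD => -[] /eqP.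
by rewrite addrC -subr_eq0 opprD addNKr oppr_eq0 oner_eq0.
Qed.

(** A positive integer time U is the number of n with U > n. *)
Lemma hitting_time_esum (y : S) (w : T) :
  hitting_time R Y y w = \esum_(n in [set: nat]) (\1_(avoids y n) w : R)%:E.
Proof.
have [[m [avoid_m Ym ->]]|[avoid_y ->]] := hitting_timeP y w; last first.
  rewrite -esum_nat1; apply: eq_esum => n _.
  by rewrite indicE mem_set.
rewrite -esum_lt_nat; apply: eq_esum => n _; rewrite indicE ltnS.
have [nm|mn] := leqP n m.
  rewrite mem_set// => k /andP[k0 kn].
  by apply: avoid_m; rewrite k0 (leq_trans kn).
by rewrite memNset// => /(_ m.+1); rewrite mn => /(_ isT).
Qed.

End hitting_time.

(** * From the Markov property to taboo probabilities *)

Lemma countable_seqT (C : Type) :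
  countable [set: C] -> countable [set: seq C].
Proof.
move=> /countable_injP[f f_inj].
apply/countable_injP; exists (fun s => choice.pickle (map f s)) => s s' _ _.
move=> /(pcan_inj choice.pickleK); apply: inj_map => c c' fcc'.
by apply: f_inj fcc'; rewrite inE.
Qed.

Lemma measurable_preimage_countable d (T : measurableType d) (C : Type)
    (X : T -> C) (B : set C) :
  countable [set: C] -> (forall c, measurable (X @^-1` [set c])) ->
  measurable (X @^-1` B).
Proof.
move=> C_countable mX.
rewrite (_ : _ @^-1` _ = \bigcup_c [set w | X w = c /\ B c]); last first.
  by apply/seteqP; split => [w Bw|w [c _ [/= -> //]]]; exists (X w).
apply: countable_bigcupT_measurable => // c.
have [Bc|nBc] := pselect (B c).
  rewrite (_ : [set _ | _] = X @^-1` [set c])//.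
  by apply/seteqP; split => w; [case|split].
by rewrite (_ : [set _ | _] = set0)//; apply/seteqP; split => // w [].
Qed.

Section markov.
Local Open Scope ereal_scope.
Variables (R : realType) (S : choiceType) (d : measure_display).
Variables (T : measurableType d) (P : S -> probability T R).
Variables (Y : nat -> T -> S) (Q : S -> S -> R).
Hypothesis S_countable : countable [set: S].
Hypothesis Q_transition : transition_function Q.
Hypothesis Y_markov : markov_chain P Y Q.

Definition trajectory (n : nat) (w : T) : seq S := mkseq (Y ^~ w) n.
Arguments trajectory : simpl never.

Let measurable_Y n A : measurable (Y n @^-1` A).
Proof. by case: Y_markov. Qed.

Lemma trajectoryS n w : trajectory n.+1 w = rcons (trajectory n w) (Y n w).
Proof. exact: mkseqS. Qed.

Lemma measurable_trajectory n B : measurable (trajectory n @^-1` B).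
Proof.
apply: measurable_preimage_countable; first exact: countable_seqT.
elim: n => [|n IHn] s.
  have [->|s_neq] := eqVneq s [::].
    by rewrite (_ : _ @^-1` _ = setT)//; apply/seteqP; split.
  rewrite (_ : _ @^-1` _ = set0)//; apply/seteqP; split => // w /= ws.
  by rewrite -ws in s_neq.
case/lastP: s => [|s z].
  by rewrite (_ : _ @^-1` _ = set0)//; apply/seteqP; split.
rewrite (_ : _ @^-1` _ = trajectory n @^-1` [set s] `&` Y n @^-1` [set z]).
  exact: measurableI.
apply/seteqP; split => w /=; rewrite trajectoryS.
  by move=> /rcons_inj[-> ->].
by move=> [-> ->].
Qed.

Lemma trajectoryP n s (x : S) w :
  trajectory n w = s <->
  size s = n /\ forall k : nat, (k < n)%N -> Y k w = nth x s k.
Proof.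
split=> [<-|[sz_s Ys]].
  by rewrite size_mkseq; split => // k kn; rewrite nth_mkseq.
apply: (@eq_from_nth _ x); rewrite size_mkseq ?sz_s// => k kn.
by rewrite nth_mkseq// Ys.
Qed.

(** The Markov property conditions on a complete path; summing over the
    countably many paths of B that end at v extends it to an arbitrary event of
    the past. *)
Lemma markov_past x n B v z :
  P x [set w | [/\ B (trajectory n.+1 w), Y n w = v & Y n.+1 w = z]]
  = P x [set w | B (trajectory n.+1 w) /\ Y n w = v] * (Q v z)%:E.
Proof.
have traj_n w : Y n w = nth x (trajectory n.+1 w) n by rewrite nth_mkseq.
have C_seq : countable [set: seq S] by exact: countable_seqT.
have mtraj s : measurable (trajectory n.+1 @^-1` [set s]).
  exact: measurable_trajectory.
have -> : [set w | [/\ B (trajectory n.+1 w), Y n w = v & Y n.+1 w = z]]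
    = trajectory n.+1 @^-1` [set s | B s /\ nth x s n = v]
      `&` Y n.+1 @^-1` [set z].
  by apply/seteqP; split => w /=; rewrite -traj_n; [case|case => -[]].
have -> : [set w | B (trajectory n.+1 w) /\ Y n w = v]
    = trajectory n.+1 @^-1` [set s | B s /\ nth x s n = v].
  by apply/seteqP; split => w /=; rewrite -traj_n.
set A := trajectory n.+1 @^-1` _.
have mA : measurable A by exact: measurable_trajectory.
have mAz := measurableI _ _ mA (measurable_Y n.+1 [set z]).
rewrite (measure_partition (P x) C_seq mAz mtraj).
rewrite [in RHS](measure_partition (P x) C_seq mA mtraj).
rewrite [RHS]muleC -ge0_esumZl// ?lee_fin; last by case: Q_transition.
apply: eq_esum => s _; rewrite muleC.
have [[sz_s [Bs vs]]|nAs] :=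
  pselect (size s = n.+1 /\ (B s /\ nth x s n = v)); last first.
  have empty : A `&` trajectory n.+1 @^-1` [set s] = set0.
    apply/seteqP; split => // w [Aw ws]; apply: nAs; split; last by rewrite -ws.
    by rewrite -ws size_mkseq.
  by rewrite setIAC empty set0I measure0 mul0e.
have atom : trajectory n.+1 @^-1` [set s]
    = [set w | forall k : nat, (k <= n)%N -> Y k w = nth x s k].
  apply/seteqP; split => w /=.
    by move=> /(trajectoryP _ _ x)[_ Ys] k kn; rewrite Ys.
  by move=> Ys; apply/(trajectoryP _ _ x); split.
have sA : trajectory n.+1 @^-1` [set s] `<=` A.
  by move=> w /= ws; rewrite /A /= ws.
rewrite setIAC (setIidr sA) atom -vs.
by have [_ _ /(_ x n (nth x s) z) <-] := Y_markov.
Qed.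

Lemma start_almost_sure x A : measurable A ->
  P x A = P x (A `&` [set w | Y 0%N w = x]).
Proof.
move=> mA; have m0 : measurable [set w | Y 0%N w = x].
  exact: (measurable_Y 0 [set x]).
rewrite {1}(measureDI (P x) mA m0) [X in X + _](_ : _ = 0) ?add0e//.
apply: (@subset_measure0 _ _ _ _ _ (~` [set w | Y 0%N w = x])).
- exact: measurableD.
- exact: measurableC.
- by move=> w [].
- rewrite [LHS](probability_setC (P x) m0); have [_ -> _] := Y_markov.
  by rewrite subee.
Qed.

Lemma measurable_avoids y n : measurable (avoids Y y n).
Proof.
rewrite (_ : avoids Y y n = \bigcap_k
    (if (0 < k <= n)%N then Y k @^-1` [set~ y] else setT)); last first.
  apply/seteqP; split => w av k.
    by move=> _; case: ifP => // kn; exact: av.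
  by have := av k I; case: ifP.
by apply: bigcapT_measurable => k; case: ifP.
Qed.

Lemma measurable_avoids_at y n z :
  measurable [set w | avoids Y y n w /\ Y n.+1 w = z].
Proof.
exact: measurableI (measurable_avoids _ _) (measurable_Y n.+1 [set z]).
Qed.

Lemma avoidsS y n w : avoids Y y n.+1 w <-> avoids Y y n w /\ Y n.+1 w <> y.
Proof.
split=> [av|[av Yn] k /andP[k0]].
  split=> [k /andP[k0 kn]|]; last by apply: av; rewrite /= leqnn.
  by apply: av; rewrite k0 leqW.
by rewrite leq_eqVlt => /orP[/eqP->//|kn]; apply: av; rewrite k0.
Qed.

(** Conditioning on the state v at time n+1, which must differ from y, turns the
    Markov property into the recursion that defines [taboo]. *)
Lemma probability_avoids_at x y n z :
  P x [set w | avoids Y y n w /\ Y n.+1 w = z] = taboo Q y n x z.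
Proof.
elim: n z => [|n IHn] z.
  rewrite (_ : [set _ | _] = Y 1%N @^-1` [set z]); last first.
    by apply/seteqP; split => w; [case|split => // -[|k]].
  rewrite start_almost_sure//.
  have [_ /(_ x) P0 /(_ x 0%N (fun _ => x) z)] := Y_markov.
  rewrite (_ : [set w | forall k, _] = [set w | Y 0%N w = x]); last first.
    by apply/seteqP; split => w /= => [/(_ 0%N isT)//|w0 [|k]].
  rewrite P0 mul1e /= => <-; congr (P x _); apply/seteqP; split => w /=.
    by move=> [-> w0]; split => // -[|k].
  by move=> [/(_ 0%N isT) w0 ->].
rewrite tabooSr (measure_partition (X := Y n.+1) (P x) S_countable)//;
  last first.
  exact: measurable_avoids_at.
rewrite (esumD1 y)// [X in X + _](_ : _ = 0); last first.
  rewrite (_ : _ `&` _ = set0)//; apply/seteqP; split => // w /=.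
  by move=> [[/avoidsS[]]].
rewrite add0e; apply: eq_esum => v vy; rewrite -IHn.
pose B (s : seq S) := forall k : nat, (0 < k <= n)%N -> nth x s k <> y.
have B_avoids w : B (trajectory n.+2 w) <-> avoids Y y n w.
  split=> av k kn; have := av k kn; rewrite nth_mkseq//; case/andP: kn => _ kn;
    by rewrite ltnS leqW.
have := markov_past x n.+1 B v z.
rewrite (_ : [set w | B _ /\ _] = [set w | avoids Y y n w /\ Y n.+1 w = v]).
  move=> <-; congr (P x _); apply/seteqP; split => w /=.
    by move=> [[/avoidsS[/B_avoids ? _] ?] ?].
  move=> [/B_avoids ? Yv ?]; split => //; split => //.
    by apply/avoidsS; rewrite Yv.
by apply/seteqP; split => w [/B_avoids].
Qed.

Lemma probability_avoids x y n : P x (avoids Y y n) = avoid_prob Q y n x.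
Proof.
rewrite (measure_partition (X := Y n.+1) (P x) S_countable)//; last first.
  exact: measurable_avoids.
by apply: eq_esum => z _; exact: probability_avoids_at.
Qed.

Lemma hits_bigcup y :
  [set w | hitting_time R Y y w < +oo]
  = \bigcup_n [set w | avoids Y y n w /\ Y n.+1 w = y].
Proof.
apply/seteqP; split => w /=; first by move=> /hitting_time_lty[n]; exists n.
by move=> [n _ wn]; apply/hitting_time_lty; exists n.
Qed.

Lemma measurable_hit y : measurable [set w | hitting_time R Y y w < +oo].
Proof.
rewrite hits_bigcup; apply: bigcupT_measurable => n.
exact: measurable_avoids_at.
Qed.

Lemma probability_hit x y :
  P x [set w | hitting_time R Y y w < +oo] = hit_prob Q y x.
Proof.
rewrite hits_bigcup measure_bigcup//.
- rewrite nneseries_esum//; rewrite (_ : [set _ | _] = setT); last first.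
    by apply/seteqP; split => // n; rewrite /= inE.
  by apply: eq_esum => n _; exact: probability_avoids_at.
- by move=> n _; exact: measurable_avoids_at.
- have later m n w : (m < n)%N -> avoids Y y n w -> Y m.+1 w <> y.
    by move=> mn av; apply: av.
  move=> m n _ _ [w [[avm Ym] [avn Yn]]].
  by have [/later/(_ avn)|/later/(_ avm)|] := ltngtP m n.
Qed.

Lemma expected_return_timeE x :
  expected_return_time P Y x = \esum_(n in [set: nat]) avoid_prob Q x n x.
Proof.
rewrite /expected_return_time.
transitivity (\int[P x]_w (\sum_(n <oo) (\1_(avoids Y x n) w : R)%:E)).
  by apply: eq_integral => w _; rewrite hitting_time_esum nneseries_esumT.
rewrite integral_nneseries//; last first.
  move=> n; apply/measurable_EFinP; apply: measurable_indic.
  exact: measurable_avoids.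
rewrite nneseries_esumT; last by move=> n; exact: integral_ge0.
apply: eq_esum => n _; rewrite integral_indic//; last exact: measurable_avoids.
by rewrite setIT; exact: probability_avoids.
Qed.

Let step n w := (Y n w, Y n.+1 w).

Let SS_countable : countable [set: S * S].
Proof. by rewrite -setXTT; exact: countableX. Qed.

Let mstep n B : measurable (step n @^-1` B).
Proof.
apply: measurable_preimage_countable => // -[v z].
rewrite (_ : _ @^-1` _ = Y n @^-1` [set v] `&` Y n.+1 @^-1` [set z]).
  exact: measurableI.
by apply/seteqP; split => w; [case=> /= -> ->|case=> /= <- <-].
Qed.

Lemma measurable_impossible_step :
  measurable [set w | exists n, Q (Y n w) (Y n.+1 w) = 0%R].
Proof.
rewrite (_ : [set _ | _] =
    \bigcup_n (step n @^-1` [set vz : S * S | Q vz.1 vz.2 = 0%R])).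
  by apply: bigcupT_measurable => n; exact: mstep.
by apply/seteqP; split => w [n]; exists n.
Qed.

(** Only countably many pairs of states are involved, and a given pair (v, z)
    occurs at a given time with probability P(Y_n = v) Q(v,z). *)
Lemma impossible_step_null x :
  P x [set w | exists n, Q (Y n w) (Y n.+1 w) = 0%R] = 0.
Proof.
pose D := [set vz : S * S | Q vz.1 vz.2 = 0%R].
have -> : [set w | exists n, Q (Y n w) (Y n.+1 w) = 0%R]
    = \bigcup_n (step n @^-1` D).
  by apply/seteqP; split => w [n]; exists n.
apply: measure_negligible.
  by apply: bigcupT_measurable => n; exact: mstep.
apply: negligible_bigcup => n; apply/negligibleP; first exact: mstep.
rewrite [LHS](measure_partition (P x) SS_countable (mstep n D)
  (fun c => mstep n [set c])).
apply: esum1 => -[v z] _; have [Qvz|Qvz] := eqVneq (Q v z) 0%R; last first.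
  rewrite (_ : _ `&` _ = set0) ?measure0//; apply/seteqP; split => // w /=.
  by rewrite /D/= => -[Q0 [Yv Yz]]; rewrite -Yv -Yz Q0 eqxx in Qvz.
have /= := markov_past x n setT v z; rewrite Qvz mule0 => P0.
apply: subset_measure0 P0.
- by apply: measurableI; exact: mstep.
- rewrite (_ : [set _ | _] = step n @^-1` [set (v, z)]); first exact: mstep.
  by apply/seteqP; split => w; rewrite /step /=; [case=> _ -> ->|case=> -> ->].
- by move=> w [_ /= [-> ->]].
Qed.

End markov.

(** * Downward run chains *)

(** An infinite descent from x, together with e, would be an infinite chain from
    e to x. *)
Lemma finite_chains_wf (o : Order.disp_t) (S : porderType o) (e : S) :
  minimum_element e ->
  (forall (x : S) (C : set S), chain_from_to e x C -> finite_set C) ->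
  well_founded (fun x y : S => (x < y)%O).
Proof.
move=> e_min finite_chains x; apply: contrapT => x_nacc.
pose bad := {z : S | ~ Acc (fun x y : S => (x < y)%O) z}.
have next (z : bad) : {t : bad | (sval t < sval z)%O}.
  apply: cid; case: z => z z_nacc /=; apply: contrapT => no.
  apply: z_nacc; constructor => t tz; apply: contrapT => t_nacc.
  by apply: no; exists (exist _ t t_nacc).
have [f [f0 f_lt]] := dependent_choice next (exist _ x x_nacc).
pose u n := sval (f n).
have u_anti m n : (m < n)%N -> (u n < u m)%O.
  elim: n => // n IHn; rewrite ltnS leq_eqVlt => /orP[/eqP->|/IHn].
    exact: f_lt.
  exact: lt_trans (f_lt n).
have u_le m n : (m <= n)%N -> (u n <= u m)%O.
  by rewrite leq_eqVlt => /orP[/eqP->//|/u_anti/ltW].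
have u_inj : injective u.
  move=> m n umn; have [/u_anti|/u_anti|//] := ltngtP m n;
    by rewrite umn ltxx.
have chain_u : chain_from_to e x (e |` range u).
  split; [|by left|by right; exists 0%N => //; rewrite /u f0|].
  - move=> s t [->|[m _ <-]] [->|[n _ <-]]; rewrite ?e_min; try by [left|right].
    by have [/u_le|/ltnW/u_le] := leqP m n; [right|left].
  - move=> t [->|[n _ <-]]; split=> //.
    by have := u_le 0%N n isT; rewrite {2}/u f0.
have := finite_chains _ _ chain_u; rewrite finite_setU => -[_].
by rewrite (eq_finite_set (inj_card_eq (in2W u_inj))); exact: infinite_nat.
Qed.

Section downward_run_chain.
Local Open Scope ereal_scope.
Variables (R : realType) (o : Order.disp_t) (S : porderType o) (e : S).
Variables (d : measure_display) (T : measurableType d).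
Variables (P : S -> probability T R) (Y : nat -> T -> S) (Q : S -> S -> R).
Hypothesis S_countable : countable [set: S].
Hypothesis S_wf : well_founded (fun x y : S => (x < y)%O).
Hypothesis Y_run : downward_run_chain e P Y Q.

Let Q_transition : transition_function Q. Proof. by case: Y_run. Qed.
Let Y_markov : markov_chain P Y Q. Proof. by case: Y_run. Qed.
Let Q_downward : downward_run_transition e Q. Proof. by case: Y_run. Qed.

Lemma downward_run_step x z : x <> e -> (0 < Q x z)%R -> (z < x)%O.
Proof. by move=> xe /Q_downward[//|[_ []]]. Qed.

Lemma downward_run_jump z : (0 < Q e z)%R.
Proof. by apply/Q_downward; left. Qed.

Lemma downward_run_hit y x : hit_prob Q y x = 1.
Proof.
exact: (hit_prob_eq1 Q_transition S_wf downward_run_step downward_run_jump).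
Qed.

Lemma downward_run_hits_almost_surely x y :
  P x [set w | hitting_time R Y y w < +oo] = 1.
Proof.
by rewrite (probability_hit S_countable Q_transition)// downward_run_hit.
Qed.

Lemma downward_trajectory w n m :
  (forall k, Q (Y k w) (Y k.+1 w) <> 0%R) ->
  (forall k, (n < k <= m)%N -> Y k w <> e) -> (n < m)%N ->
  (Y m.+1 w < Y n.+1 w)%O.
Proof.
move=> possible.
have step k : Y k w <> e -> (Y k.+1 w < Y k w)%O.
  move=> Yk; apply: downward_run_step => //.
  by rewrite lt0r; apply/andP; split; [apply/eqP|case: Q_transition].
elim: m => // m IHm off_e; rewrite ltnS leq_eqVlt => /orP[/eqP nm|nm].
  by rewrite nm; apply: step; apply: off_e; rewrite nm !leqnn.
apply: (lt_trans (step m.+1 _)); first by apply: off_e; rewrite leqnn ltnS ltnW.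
by apply: IHm nm => k /andP[nk km]; apply: off_e; rewrite nk leqW.
Qed.

(** The events that x is visited at time n+1 with no return to e at the times
    1, ..., n are disjoint for different n once the null event of an impossible
    step is removed: two visits to x within an excursion would contradict strict
    descent.  So the probability of their union is the sum of their
    probabilities. *)
Lemma hit_before_returnE x :
  hit_before_return P Y e x = excursion_visits Q e x.
Proof.
pose E n := [set w | avoids Y e n w /\ Y n.+1 w = x].
pose N := [set w | exists n, Q (Y n w) (Y n.+1 w) = 0%R].
have m_avoids y n : measurable (avoids Y y n).
  exact: (measurable_avoids Y_markov).
have mE n : measurable (E n) by exact: (measurable_avoids_at Y_markov).
have mN : measurable N.
  exact: (measurable_impossible_step S_countable Y_markov).
have PN : P e N = 0.
  exact: (impossible_step_null S_countable Q_transition Y_markov).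
have PE A : measurable A -> P e A = P e (A `\` N).
  move=> mA; rewrite [LHS](measureDI (P e) mA mN) [X in _ + X](_ : _ = 0).
    by rewrite adde0.
  by apply: subset_measure0 PN => //; exact: measurableI.
(* The hitting times of x and e may also compare because both are infinite; this
   happens with probability zero by recurrence. *)
pose never := [set w | forall n, avoids Y x n w /\ avoids Y e n w].
have m_never : measurable never.
  rewrite (_ : never = \bigcap_n (avoids Y x n `&` avoids Y e n)).
    by apply: bigcapT_measurable => n; exact: measurableI.
  by apply/seteqP; split => w /= h n; [move=> _|]; exact: h.
have P_never : P e never = 0.
  apply: (@subset_measure0 _ _ _ _ _
      (~` [set w | (hitting_time R Y x w < +oo)%E])) => //.
  - exact: measurableC (measurable_hit Y_markov x).
  - move=> w /= h; rewrite hitting_time_lty => -[n [_ Yn]].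
    by have [/(_ n.+1)] := h n.+1; rewrite leqnn => /(_ isT).
  - rewrite [LHS](probability_setC (P e) (measurable_hit Y_markov x)).
    by rewrite downward_run_hits_almost_surely subee.
rewrite /hit_before_return.
rewrite (_ : [set _ | _] = \bigcup_n E n `|` never); last first.
  apply/seteqP; split => w /=.
    by move=> /hitting_time_le[[n wn]|]; [left; exists n|right].
  move=> h; apply/hitting_time_le.
  by case: h => [[n _ wn]|]; [left; exists n|right].
transitivity (P e (\bigcup_n E n)).
  by apply: measureU0 => //; exact: bigcupT_measurable.
rewrite PE; last exact: bigcupT_measurable.
rewrite setDE setI_bigcupl measure_bigcup//; last 2 first.
- by move=> n _; exact: measurableD.
- have later m n w : (m < n)%N -> (E m `\` N) w -> (E n `\` N) w -> False.
    move=> mn [[_ Ym] nN] [[avn Yn] _].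
    suff : (Y n.+1 w < Y m.+1 w)%O by rewrite Ym Yn ltxx.
    apply: downward_trajectory mn => [k Q0|k /andP[mk kn]].
      by apply: nN; exists k.
    by apply: avn; rewrite kn (leq_ltn_trans _ mk).
  move=> m n _ _ [w [wm wn]]; have [mn|nm|//] := ltngtP m n.
    by case: (later _ _ _ mn wm wn).
  by case: (later _ _ _ nm wn wm).
rewrite nneseries_esum//; rewrite (_ : [set _ | _] = setT); last first.
  by apply/seteqP; split => // n; rewrite /= inE.
apply: eq_esum => n _.
rewrite -(probability_avoids_at S_countable Q_transition Y_markov).
exact: esym (PE _ (mE n)).
Qed.

Local Notation G := (hit_before_return P Y e).
Local Notation nu := (total_hit_before_return P Y e).

(** Both sides count the steps of one excursion from e, the right-hand side by
    the state reached. *)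
Lemma expected_return_time_min : expected_return_time P Y e = nu.
Proof.
rewrite (expected_return_timeE S_countable Q_transition Y_markov).
rewrite -(excursion_visits_mass Q_transition).
by apply: eq_esum => x _; rewrite hit_before_returnE.
Qed.

Lemma hit_before_return_ge0 x : 0 <= G x.
Proof. exact: measure_ge0. Qed.
Hint Resolve hit_before_return_ge0 : core.

Lemma hit_before_return_gt0 x : 0 < G x.
Proof.
apply: (@lt_le_trans _ _ (Q e x)%:E).
  by rewrite lte_fin downward_run_jump.
rewrite hit_before_returnE; apply: (le_esum_term 0%N) => n.
exact: (taboo_ge0 Q_transition).
Qed.

Lemma total_hit_before_return_gt0 : 0 < nu.
Proof.
apply: lt_le_trans (hit_before_return_gt0 e) _.
exact: (le_esum_term e (a := fun x => G x)).
Qed.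

Lemma hit_before_return_invariant y :
  \esum_(x in [set: S]) G x * (Q x y)%:E = G y.
Proof.
rewrite [RHS]hit_before_returnE.
rewrite -(excursion_visits_invariant Q_transition y (downward_run_hit e e)).
by apply: eq_esum => x _; rewrite hit_before_returnE.
Qed.

Definition excursion_density (x : S) : R := (fine (G x) / fine nu)%R.

Hypothesis nu_fin : nu < +oo.

Let nu_fin_num : nu \is a fin_num.
Proof. by rewrite gt0_fin_numE// total_hit_before_return_gt0. Qed.

Let hit_before_return_fin_num x : G x \is a fin_num.
Proof.
rewrite ge0_fin_numE//; apply: le_lt_trans nu_fin.
exact: (le_esum_term x (a := fun x => G x)).
Qed.

Let fine_nu_gt0 : (0 < fine nu)%R.
Proof. by rewrite fine_gt0// total_hit_before_return_gt0. Qed.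

Lemma excursion_densityE x : (excursion_density x)%:E = G x / nu.
Proof.
rewrite -[in RHS](fineK (hit_before_return_fin_num x)).
rewrite -[in RHS](fineK nu_fin_num).
by rewrite inver gt_eqF// -EFinM.
Qed.

Lemma excursion_densityVE x : ((excursion_density x)^-1)%:E = nu / G x.
Proof.
rewrite -[in RHS](fineK (hit_before_return_fin_num x)).
rewrite -[in RHS](fineK nu_fin_num).
rewrite inver gt_eqF -?EFinM ?invf_div// fine_gt0// hit_before_return_gt0.
by rewrite -ge0_fin_numE// hit_before_return_fin_num.
Qed.

Lemma excursion_density_gt0 x : (0 < excursion_density x)%R.
Proof.
rewrite divr_gt0// fine_gt0// hit_before_return_gt0.
by rewrite -ge0_fin_numE// hit_before_return_fin_num.
Qed.

Lemma excursion_density_invariant : invariant_density Q excursion_density.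
Proof.
have scale (a : S -> R) : (forall x, (0 <= a x)%R) ->
    \esum_(x in [set: S]) (excursion_density x * a x)%:E
    = ((fine nu)^-1)%:E * \esum_(x in [set: S]) G x * (a x)%:E.
  move=> a0; rewrite -ge0_esumZl ?lee_fin ?invr_ge0 ?ltW//; last first.
    by move=> x; rewrite mule_ge0// lee_fin.
  apply: eq_esum => x _; rewrite -[in RHS](fineK (hit_before_return_fin_num x)).
  by rewrite -!EFinM /excursion_density mulrA [(_^-1 * _)%R]mulrC.
have invE : ((fine nu)^-1)%:E * nu = 1.
  by rewrite -{2}(fineK nu_fin_num) -EFinM mulVf// gt_eqF.
split=> [x||y].
- exact: ltW (excursion_density_gt0 x).
- transitivity (\esum_(x in [set: S]) (excursion_density x * 1)%:E).
    by apply: eq_esum => x _; rewrite mulr1.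
  rewrite scale// -[RHS]invE; congr (_ * _); apply: eq_esum => x _.
  by rewrite mule1.
- rewrite scale; last by move=> x; case: Q_transition.
  rewrite hit_before_return_invariant.
  rewrite -(fineK (hit_before_return_fin_num y)) -EFinM.
  by rewrite /excursion_density mulrC.
Qed.

Lemma invariant_density_expected_return g x :
  invariant_density Q g -> (g x)%:E * expected_return_time P Y x = 1.
Proof.
move=> g_inv; rewrite (expected_return_timeE S_countable Q_transition Y_markov).
exact: (invariant_density_return Q_transition (downward_run_hit x) g_inv).
Qed.

Lemma expected_return_time_finite x :
  expected_return_time P Y x = ((excursion_density x)^-1)%:E.
Proof.
have d_gt0 := excursion_density_gt0 x.
rewrite -[LHS]mul1e -[X in X%:E * _ = _](mulVf (lt0r_neq0 d_gt0)).
have kac := invariant_density_expected_return x excursion_density_invariant.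
by rewrite EFinM -muleA kac mule1.
Qed.

End downward_run_chain.

Theorem mainTheorem6 (R : realType) (o : Order.disp_t) (S : porderType o)
  (e : S)
  (S_countable : countable [set: S])
  (e_min : minimum_element e)
  (finite_chains : forall (x : S) (C : set S),
     chain_from_to e x C -> finite_set C)
  (d : measure_display) (T : measurableType d)
  (P : S -> probability T R) (Y : nat -> T -> S) (Q : S -> S -> R)
  (Y_run : downward_run_chain e P Y Q) :
  let G := hit_before_return P Y e in
  let nu_e := total_hit_before_return P Y e in
  [/\ recurrent P Y,
      positive_recurrent P Y <-> (nu_e < +oo)%E
    & (nu_e < +oo)%E ->
      (forall g : S -> R,
         invariant_density Q g <-> forall x : S, (g x)%:E = (G x / nu_e)%E) /\
      (forall x : S, expected_return_time P Y x = (nu_e / G x)%E)].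
Proof.
have S_wf := finite_chains_wf e_min finite_chains.
move=> G nu_e; split.
- by move=> x; apply: (downward_run_hits_almost_surely S_countable S_wf Y_run).
- split=> [|nu_fin x].
    by rewrite /nu_e -(expected_return_time_min S_countable S_wf Y_run); exact.
  by rewrite (expected_return_time_finite S_countable S_wf Y_run)// ltry.
- move=> nu_fin; have dE := excursion_densityE S_countable S_wf Y_run nu_fin.
  have d_gt0 := excursion_density_gt0 S_countable S_wf Y_run nu_fin.
  have d_inv := excursion_density_invariant S_countable S_wf Y_run nu_fin.
  have returnE := expected_return_time_finite S_countable S_wf Y_run nu_fin.
  split=> [g|x].
    split=> [g_inv x|gE].
      have := invariant_density_expected_return S_countable S_wf Y_run x g_inv.
      rewrite returnE -EFinM -dE => -[] /(canRL (mulfVK _)) ->.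
        by rewrite mul1r.
      by rewrite gt_eqF.
    by rewrite (_ : g = excursion_density e P Y)//; apply/funext => x;
      apply/EFin_inj; rewrite gE dE.
  by rewrite returnE (excursion_densityVE S_countable S_wf Y_run).
Qed.
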